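(* Let $K$ be an algebraically closed field of characteristic zero and let $\mathfrak{g}\in\mathfrak{A}^2_{12}(K)$, with adapted basis $(e_1,\dots,e_{12})$. Then $H^2(\mathfrak{g},K)=\mathrm{span}\{[\omega_1],[\omega_2],[\omega]\}$, where $\omega$ is an affine $2$-cocycle.
   Context: A nilpotent Lie algebra $\mathfrak{g}$ of dimension $n$ is filiform if $\mathfrak{g}^{n-1}=0\ne\mathfrak{g}^{n-2}$, where $\mathfrak{g}^0=\mathfrak{g}$, $\mathfrak{g}^k=[\mathfrak{g}^{k-1},\mathfrak{g}]$. $\mathfrak{A}^2_{12}(K)$ is the class of $12$-dimensional filiform Lie algebras $\mathfrak{g}$ over $K$ such that: (b) $\mathfrak{g}$ contains no one-codimensional subspace $U\supseteq\mathfrak{g}^1$ with $[U,\mathfrak{g}^1]\subseteq\mathfrak{g}^4$; (c) $\mathfrak{g}^{4}$ is abelian (this is $\mathfrak{g}^{(n-4)/2}$ for $n=12$); and $[\mathfrak{g}^1,\mathfrak{g}^1]\not\subseteq\mathfrak{g}^6$. A basis $(e_1,\dots,e_n)$ of an $n$-dimensional filiform Lie algebra is adapted if there are $\alpha_{k,s}\in K$, vanishing unless $2\le k\le[n/2]$, $2k+1\le s\le n$, or ($n$ even and $(k,s)=(\frac n2,n)$), with $[e_1,e_i]=e_{i+1}$ for $2\le i\le n-1$, $[e_1,e_n]=0$, and $[e_i,e_j]=\sum_{r=1}^n\bigl(\sum_{\ell=0}^{[(j-i-1)/2]}(-1)^\ell\binom{j-i-\ell-1}{\ell}\alpha_{i+\ell,\,r-j+i+2\ell+1}\bigr)e_r$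 for $2\le i<j\le n$. Every filiform Lie algebra over $K$ has an adapted basis. $H^2(\mathfrak{g},K)$ is Lie algebra cohomology with trivial coefficients. The $2$-cocycles $\omega_1,\omega_2$ are given by $\omega_1(e_2\wedge e_3)=1$, respectively $\omega_2(e_2\wedge e_5)=1$, $\omega_2(e_3\wedge e_4)=-1$, all other values on $e_i\wedge e_j$, $i<j$, being zero. A $2$-cocycle $\omega\in Z^2(\mathfrak{g},K)$ is affine if it is nonzero on $\mathfrak{z}(\mathfrak{g})\wedge\mathfrak{g}$, with $\mathfrak{z}(\mathfrak{g})$ the center. *)

(* Defs.v *)
From HB Require Import structures.
From mathcomp Require Import all_boot all_algebra.
From mathcomp Require Import generic_quotient ring_quotient.
From mathcomp Require Import ring zify.

Set Implicit Arguments.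
Unset Strict Implicit.
Unset Printing Implicit Defensive.

Import GRing.Theory.
Local Open Scope ring_scope.
Local Open Scope quotient_scope.

(* Multilinear maps are represented in curried form, as elements of
   'Hom(U, 'Hom(V, W)) and so on, so that they form vector spaces. *)
Section Currying.

Variable K : fieldType.
Implicit Types U V W X : vectType K.

Definition linfun2 U V W (b : U -> V -> W) : 'Hom(U, 'Hom(V, W)) :=
  linfun (fun x => linfun (b x)).

Definition linfun3 U V W X (t : U -> V -> W -> X) :
    'Hom(U, 'Hom(V, 'Hom(W, X))) :=
  linfun (fun x => linfun2 (t x)).

Lemma linfunE U V (f : U -> V) : linear f -> linfun f =1 f.
Proof.
move=> lin_f x.
pose fL : {linear U -> V} :=
  HB.pack f (GRing.isLinear.Build K U V _ f lin_f).
exact: (lfunE fL).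
Qed.

Lemma lfun_linear U V (f : 'Hom(U, V)) : linear f.
Proof. by move=> a u v; exact: linearP. Qed.

Lemma linfun2E U V W (b : U -> V -> W) :
  bilinear_for *:%R *:%R b -> forall x y, linfun2 b x y = b x y.
Proof.
move=> [linl linr] x y; rewrite /linfun2 linfunE ?linfunE // => a u v.
by apply/lfunP=> z; rewrite add_lfunE scale_lfunE !linfunE // (linl z).
Qed.

Lemma linfun3E U V W X (t : U -> V -> W -> X) :
    (forall x, bilinear_for *:%R *:%R (t x)) ->
    (forall y z, linear (fun x => t x y z)) ->
  forall x y z, linfun3 t x y z = t x y z.
Proof.
move=> bil lin1 x y z; rewrite /linfun3 linfunE ?linfun2E //.
move=> a u v; apply/lfunP=> y'; apply/lfunP=> z'.
by rewrite !(add_lfunE, scale_lfunE) !linfun2E // lin1.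
Qed.

End Currying.

Section QuotientSpace.

Variables (K : fieldType) (V : vectType K) (W : {vspace V}).

Definition vquot : Type := Quotient.quot W.

HB.instance Definition _ := GRing.Zmodule.on vquot.

Definition vquot_class (v : V) : vquot := \pi_(Quotient.quot W) v.

Lemma vquot_classP u v :
  reflect (vquot_class u = vquot_class v) (u - v \in W).
Proof. by rewrite Quotient.idealrBE; apply: eqP. Qed.

Lemma vquot_reprK : cancel (fun q : vquot => repr q) vquot_class.
Proof. exact: reprK. Qed.

Lemma vquot_classD u v :
  vquot_class (u + v) = vquot_class u + vquot_class v.
Proof. exact: Quotient.pi_add. Qed.

Definition vquot_scale (a : K) (q : vquot) : vquot :=
  vquot_class (a *: repr q).

Lemma vquot_classZ a v :
  vquot_class (a *: v) = vquot_scale a (vquot_class v).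
Proof.
by apply/vquot_classP; rewrite -scalerBr memvZ //; apply/vquot_classP;
  rewrite vquot_reprK.
Qed.

Fact vquot_scaleA a b q :
  vquot_scale a (vquot_scale b q) = vquot_scale (a * b) q.
Proof. by rewrite -[q]vquot_reprK -!vquot_classZ scalerA. Qed.

Fact vquot_scale1 : left_id 1 vquot_scale.
Proof. by move=> q; rewrite -[q]vquot_reprK -vquot_classZ scale1r. Qed.

Fact vquot_scaleDr : right_distributive vquot_scale +%R.
Proof.
move=> a p q; rewrite -[p]vquot_reprK -[q]vquot_reprK.
by rewrite -vquot_classD -!vquot_classZ -vquot_classD scalerDr.
Qed.

Fact vquot_scaleDl q : {morph vquot_scale^~ q : a b / a + b}.
Proof.
move=> a b; rewrite -[q]vquot_reprK -!vquot_classZ -vquot_classD.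
by rewrite scalerDl.
Qed.

HB.instance Definition _ := GRing.Zmodule_isLmodule.Build K vquot
  vquot_scaleA vquot_scale1 vquot_scaleDr vquot_scaleDl.

Fact vquot_class_is_linear : linear vquot_class.
Proof. by move=> a u v; rewrite vquot_classD vquot_classZ. Qed.

HB.instance Definition _ :=
  GRing.isLinear.Build K V vquot _ vquot_class vquot_class_is_linear.

Fact vquot_vect_iso : Vector.axiom (\dim W^C) vquot.
Proof.
pose X := vbasis W^C; pose pi := daddv_pi W^C W.
have dCW : (W^C :&: W = 0)%VS by rewrite capvC capv_compl.
have freeX : free X := basis_free (vbasisP _).
pose lift (r : 'rV_(\dim W^C)) : V := \sum_i r 0 i *: X`_i.
pose g r := vquot_class (lift r).
pose f (q : vquot) : 'rV_(\dim W^C) := \row_i coord X i (pi (repr q)).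
have pi_class v : pi (repr (vquot_class v)) = pi v.
  have Wv : repr (vquot_class v) - v \in W.
    by apply/vquot_classP; rewrite vquot_reprK.
  apply/eqP; rewrite -subr_eq0 -linearB /=; apply/eqP.
  have := daddv_pi_add dCW (subvP (addvSr W^C W) _ Wv).
  rewrite [X in _ + X]daddv_pi_id 1?capvC //.
  by move/(canRL (addrK _)); rewrite subrr.
have class_pi v : vquot_class (pi v) = vquot_class v.
  have vCW : v \in (W^C + W)%VS by rewrite addvC addv_complf memvf.
  apply/vquot_classP; rewrite -memvN opprB.
  by rewrite -{1}[v](daddv_pi_add dCW) // addrC addKr memv_pi.
have gf q : g (f q) = q.
  rewrite /g /lift; under eq_bigr => i _ do rewrite mxE.
  by rewrite -coord_vbasis ?memv_pi // class_pi vquot_reprK.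
have fg r : f (g r) = r.
  apply/rowP=> i; rewrite mxE pi_class daddv_pi_id //; last first.
    by apply: rpred_sum => j _; rewrite memvZ // vbasis_mem // mem_nth ?size_tuple.
  by rewrite coord_sum_free.
have lin_g : linear g.
  move=> a u v; rewrite /g -linearP /lift scaler_sumr -big_split /=.
  by congr vquot_class; apply: eq_bigr => i _; rewrite !mxE scalerDl scalerA.
exists f; last by exists g.
by move=> a p q; rewrite -{1}[p]gf -{1}[q]gf -lin_g fg.
Qed.

HB.instance Definition _ := Lmodule_hasFinDim.Build K vquot vquot_vect_iso.

End QuotientSpace.

HB.mixin Record isLie (K : fieldType) L of Vector K L := {
  lie : L -> L -> L;
  lie_bilinear : bilinear_for *:%R *:%R lie;
  liexx : forall x : L, lie x x = 0;
  lie_jacobi : forall x y z : L,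
    lie (lie x y) z + lie (lie y z) x + lie (lie z x) y = 0
}.

#[short(type="lieAlgType")]
HB.structure Definition LieAlgebra (K : fieldType) :=
  {L of isLie K L & Vector K L}.

HB.instance Definition _ (K : fieldType) (L : lieAlgType K) :=
  bilinear_isBilinear.Build K L L L _ _ (@lie K L) lie_bilinear.

Section LieAlgebraTheory.

Variables (K : fieldType) (L : lieAlgType K).
Implicit Types (U V W : {vspace L}) (x y z : L).

Lemma lieC x y : lie x y = - lie y x.
Proof.
apply/eqP; rewrite -addr_eq0; have := liexx (x + y).
by rewrite linearDl !linearDr /= !liexx add0r addr0 => ->.
Qed.

Definition liev U V : {vspace L} :=
  <<[seq lie u v | u <- vbasis U, v <- vbasis V]>>%VS.

Lemma lievP U V W :
  reflect {in U & V, forall u v, lie u v \in W} (liev U V <= W)%VS.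
Proof.
apply: (iffP span_subvP) => [sUVW u v Uu Vv | sUVW t /allpairsP[[u v]]].
  rewrite (coord_vbasis Uu) (coord_vbasis Vv).
  rewrite linear_sumlz rpred_sum // => i _; rewrite linearZl_LR memvZ //.
  rewrite linear_sumr rpred_sum // => j _; rewrite linearZr_LR memvZ //.
  by apply: sUVW; apply: allpairs_f; rewrite mem_nth ?size_tuple.
by move=> [/= Uu Vv ->]; apply: sUVW; apply: vbasis_mem.
Qed.

Fixpoint lower_central (k : nat) : {vspace L} :=
  if k is k'.+1 then liev (lower_central k') fullv else fullv.

(* Nilpotency is implied by the vanishing of the lower central series. *)
Definition filiform : Prop :=
  lower_central (\dim {:L}).-1 = 0%VS /\ lower_central (\dim {:L}).-2 <> 0%VS.

Definition center : {vspace L} := lker (linfun2 (@lie K L)).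

Lemma centerP x : reflect (forall y, lie x y = 0) (x \in center).
Proof.
rewrite memv_ker; apply: (iffP eqP) => [ker_x y | x0].
  by rewrite -(linfun2E lie_bilinear) ker_x zero_lfunE.
by apply/lfunP=> y; rewrite (linfun2E lie_bilinear) x0 zero_lfunE.
Qed.

Definition class_A2_12 : Prop :=
  [/\ \dim {:L} = 12%N,
      filiform,
      ~ (exists U : {vspace L},
          [/\ (lower_central 1 <= U)%VS,
              (\dim U).+1 = \dim {:L} &
              (liev U (lower_central 1) <= lower_central 4)%VS]),
      liev (lower_central 4) (lower_central 4) = 0%VS &
      ~ (liev (lower_central 1) (lower_central 1) <= lower_central 6)%VS].

End LieAlgebraTheory.

Arguments lower_central {K} L k.
Arguments filiform {K} L.
Arguments center {K} L.
Arguments class_A2_12 {K} L.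

(* Cohomology with trivial coefficients in degree two. The space of 2-cochains,
   i.e. of linear forms on the second exterior power of L, is identified with
   the space of alternating bilinear forms. *)
Section Cohomology.

Variables (K : fieldType) (L : lieAlgType K).

Local Notation form1 := 'Hom(L, K^o).
Local Notation form2 := 'Hom(L, 'Hom(L, K^o)).
Local Notation form3 := 'Hom(L, 'Hom(L, 'Hom(L, K^o))).

Implicit Types (f : form1) (w : form2).

Definition symmetrize w : form2 := linfun2 (fun x y => w x y + w y x : K^o).

Definition diag_value (i : 'I_(\dim {:L})) w : K^o :=
  w (vbasis {:L})`_i (vbasis {:L})`_i.

(* The alternating forms, see cochain2P: once w x y + w y x = 0 for all x and y,
   it is enough to require w b b = 0 on a basis. *)
Definition cochain2 : {vspace form2} :=
  (lker (linfun symmetrize)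
     :&: \bigcap_(i < \dim {:L}) lker (linfun (diag_value i)))%VS.

Definition coboundary1 : 'Hom(form1, form2) :=
  linfun (fun f => linfun2 (fun x y => f (lie x y))).

Definition coboundary2 : 'Hom(form2, form3) :=
  linfun (fun w =>
    linfun3 (fun x y z => w (lie x y) z + w (lie y z) x + w (lie z x) y)).

Definition cocycles2 : {vspace form2} := (cochain2 :&: lker coboundary2)%VS.

Definition coboundaries2 : {vspace form2} := limg coboundary1.

Definition coclass (w : form2) : vquot coboundaries2 := vquot_class coboundaries2 w.

(* Z^2 / B^2, as a subspace of the quotient of all bilinear forms by B^2. *)
Definition H2 : {vspace vquot coboundaries2} := (linfun coclass @: cocycles2)%VS.

Definition affine_cocycle (w : form2) : Prop :=
  w \in cocycles2 /\ exists2 z, z \in center L & exists y, w z y <> 0.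

Let wE := (add_lfunE, scale_lfunE).

Lemma symmetrizeE w x y : symmetrize w x y = w x y + w y x.
Proof.
rewrite /symmetrize linfun2E //; split=> u a v t /=;
  by rewrite !lfun_linear !wE scalerDr addrACA.
Qed.

Lemma cochain2P w : reflect (forall x, w x x = 0) (w \in cochain2).
Proof.
have lin_sym : linear symmetrize.
  move=> a u v; apply/lfunP=> x; apply/lfunP=> y.
  by rewrite !wE !symmetrizeE !wE scalerDr addrACA.
have lin_diag i : linear (diag_value i).
  by move=> a u v; rewrite /diag_value !wE.
rewrite memv_cap memv_ker linfunE //.
apply: (iffP andP) => [[/eqP sym0 diag0] x | alt0]; last first.
  split; last first.
    rewrite memvE; apply/subv_bigcapP => i _.
    by rewrite -memvE memv_ker linfunE // /diag_value alt0.
  apply/eqP/lfunP=> x; apply/lfunP=> y; rewrite symmetrizeE !zero_lfunE.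
  by have := alt0 (x + y); rewrite linearD !linearD /= !wE !alt0 add0r addr0 addrC.
have {sym0} skew y z : w y z = - w z y.
  by apply/eqP; rewrite -addr_eq0 -symmetrizeE sym0 !zero_lfunE.
have {}diag0 (i : 'I_(\dim {:L})) : w (vbasis {:L})`_i (vbasis {:L})`_i = 0.
  move/subv_bigcapP: diag0 => /(_ i isT).
  by rewrite -memvE memv_ker linfunE // => /eqP.
rewrite (coord_vbasis (memvf x)); apply: (big_ind (fun z => w z z = 0)).
- by rewrite linear0.
- by move=> y z y0 z0; rewrite linearD !linearD /= !wE y0 z0 add0r addr0 skew addNr.
- by move=> i _; rewrite !linearZ /= wE diag0 !scaler0.
Qed.

Lemma coboundary1E f x y : coboundary1 f x y = f (lie x y).
Proof.
have lin2 (f' : form1) x' y' :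
    linfun2 (fun x y => f' (lie x y)) x' y' = f' (lie x' y').
  by rewrite linfun2E //; split=> u a v t /=; rewrite (linearPl, linearPr) lfun_linear.
rewrite linfunE ?lin2 // => a u v.
by apply/lfunP=> x'; apply/lfunP=> y'; rewrite !wE !lin2 !wE.
Qed.

Lemma coboundary2E w x y z :
  coboundary2 w x y z = w (lie x y) z + w (lie y z) x + w (lie z x) y.
Proof.
have addE (a : K) (A B C D E F : K^o) :
    (a *: A + B) + (a *: C + D) + (a *: E + F) = a *: (A + C + E) + (B + D + F).
  by rewrite [X in X + _ = _]addrACA [LHS]addrACA !scalerDr.
have lin3 (w' : form2) x' y' z' :
    linfun3 (fun x y z => w' (lie x y) z + w' (lie y z) x + w' (lie z x) y : K^o)
      x' y' z'
    = w' (lie x' y') z' + w' (lie y' z') x' + w' (lie z' x') y'.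
  rewrite linfun3E // => [t | u v a s t] /=.
    by split=> u a v s /=; rewrite !(linearPl, linearPr) !lfun_linear !wE addE.
  by rewrite !(linearPl, linearPr) !lfun_linear !wE addE.
rewrite linfunE ?lin3 // => a u v.
apply/lfunP=> x'; apply/lfunP=> y'; apply/lfunP=> z'.
by rewrite !wE !lin3 !wE addE.
Qed.

Lemma cocycles2P w :
  reflect ((forall x, w x x = 0) /\
           (forall x y z, w (lie x y) z + w (lie y z) x + w (lie z x) y = 0))
          (w \in cocycles2).
Proof.
rewrite memv_cap memv_ker.
apply: (iffP andP) => [[/cochain2P alt /eqP dw0] | [alt dw0]]; split=> //.
- by move=> x y z; rewrite -coboundary2E dw0 !zero_lfunE.
- exact/cochain2P.
- apply/eqP/lfunP=> x; apply/lfunP=> y; apply/lfunP=> z.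
  by rewrite coboundary2E dw0 !zero_lfunE.
Qed.

Lemma coboundaries2P w :
  reflect (exists f : form1, forall x y, w x y = f (lie x y))
          (w \in coboundaries2).
Proof.
apply: (iffP memv_imgP) => [[f _ ->] | [f wf]]; exists f; rewrite ?memvf //.
  exact: coboundary1E.
by apply/lfunP=> x; apply/lfunP=> y; rewrite coboundary1E.
Qed.

Lemma H2P c :
  reflect (exists2 w, w \in cocycles2 & c = coclass w) (c \in H2).
Proof.
have coclassE : linfun coclass =1 coclass.
  exact/linfunE/vquot_class_is_linear.
by apply: (iffP memv_imgP) => -[w Zw ->]; exists w; rewrite ?coclassE.
Qed.

Lemma coboundaries2_sub : (coboundaries2 <= cocycles2)%VS.
Proof.
apply/subvP=> w /coboundaries2P[f wf]; apply/cocycles2P; split=> [x | x y z].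
  by rewrite wf liexx linear0.
by rewrite !wf -!linearD lie_jacobi linear0.
Qed.

End Cohomology.

Arguments cochain2 {K} L.
Arguments cocycles2 {K} L.
Arguments coboundaries2 {K} L.
Arguments H2 {K} L.

Section AdaptedBasis.

Variables (K : fieldType) (L : lieAlgType K) (n : nat) (e : n.-tuple L).

(* Basis vectors are numbered from 1. *)
Local Notation "e_[ i ]" := (e`_(i.-1)) (format "e_[ i ]").

Definition adapted_index (k s : nat) : bool :=
  [&& 2 <= k <= n./2 & 2 * k + 1 <= s <= n]%N
  || [&& ~~ odd n, k == n./2 & s == n].

(* The second index of alpha is r - j + i + 2l + 1 as an integer; when that is
   negative, the truncated difference is 0, and alpha vanishes in both cases. *)
Definition adapted_basis : Prop :=
  basis_of fullv e /\
  exists2 alpha : nat -> nat -> K,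
    forall k s, ~~ adapted_index k s -> alpha k s = 0 &
    [/\ forall i, (2 <= i <= n.-1)%N -> lie e_[1] e_[i] = e_[i.+1],
        lie e_[1] e_[n] = 0 &
        forall i j, (2 <= i < j)%N -> (j <= n)%N ->
          lie e_[i] e_[j] =
            \sum_(1 <= r < n.+1)
              (\sum_(0 <= l < ((j - i - 1)./2).+1)
                 (-1) ^+ l * 'C(j - i - l - 1, l)%:R
                   * alpha (i + l)%N (r + i + 2 * l + 1 - j)%N) *: e_[r]].

(* The alternating form with value c i j on the pair (e_i, e_j) for i < j, when
   e is a basis; see alt_formE. *)
Definition alt_form (c : nat -> nat -> K) : 'Hom(L, 'Hom(L, K^o)) :=
  linfun2 (fun x y : L =>
    \sum_(i < n) \sum_(j < n | (i < j)%N)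
      c i.+1 j.+1 * (coord e i x * coord e j y - coord e j x * coord e i y) : K^o).

Definition omega1 : 'Hom(L, 'Hom(L, K^o)) :=
  alt_form (fun i j => if (i, j) == (2, 3)%N then 1 else 0).

Definition omega2 : 'Hom(L, 'Hom(L, K^o)) :=
  alt_form (fun i j =>
    if (i, j) == (2, 5)%N then 1 else if (i, j) == (3, 4)%N then -1 else 0).

Lemma alt_form_sumE c x y :
  alt_form c x y = \sum_(i < n) \sum_(j < n | (i < j)%N)
    c i.+1 j.+1 * (coord e i x * coord e j y - coord e j x * coord e i y).
Proof.
rewrite /alt_form linfun2E //.
have termE (a d p q r s u v : K) :
  d * ((a * p + q) * u - (a * r + s) * v)
    = a * (d * (p * u - r * v)) + d * (q * u - s * v) by ring.
have termE' (a d p q r s u v : K) :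
  d * (u * (a * r + s) - v * (a * p + q))
    = a * (d * (u * r - v * p)) + d * (u * s - v * q) by ring.
split=> u a v t /=; rewrite scaler_sumr -big_split;
  apply: eq_bigr => i _; rewrite scaler_sumr -big_split; apply: eq_bigr => j _ /=;
  rewrite !linearP; [exact: termE | exact: termE'].
Qed.

Lemma alt_form_cochain c : alt_form c \in cochain2 L.
Proof.
apply/cochain2P=> x; rewrite alt_form_sumE.
by rewrite big1 // => i _; rewrite big1 // => j _; rewrite [X in _ - X]mulrC subrr mulr0.
Qed.

Lemma alt_formE c i j : basis_of fullv e ->
  (1 <= i < j)%N -> (j <= n)%N -> alt_form c e_[i] e_[j] = c i j.
Proof.
move=> /basis_free free_e /andP[i_gt0 lt_ij] le_jn.
have ordE (k m : 'I_n) : (k < m)%N -> alt_form c e`_k e`_m = c k.+1 m.+1.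
  move=> lt_km; rewrite alt_form_sumE.
  have termE (p q : 'I_n) : (p < q)%N ->
      coord e p e`_k * coord e q e`_m - coord e q e`_k * coord e p e`_m
        = ((p == k) && (q == m))%:R.
    move=> lt_pq; rewrite !coord_free // -!natrM !mulnb ![k == _]eq_sym ![m == _]eq_sym.
    have [qk | _] := eqVneq q k; last by rewrite subr0.
    have [pm | _] := eqVneq p m; last by rewrite subr0.
    by move: lt_pq; rewrite qk pm ltnNge ltnW.
  rewrite (bigD1 k) //= (bigD1 m) //= termE // !eqxx mulr1.
  rewrite !big1 ?addr0 // => [p neq_pk | q /andP[lt_kq neq_qm]]; last first.
    by rewrite termE // (negPf neq_qm) andbF mulr0.
  by rewrite big1 // => q lt_pq; rewrite termE // (negPf neq_pk) mulr0.
have lt_j : (j.-1 < n)%N by lia.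
have lt_i : (i.-1 < n)%N by lia.
have := ordE (Ordinal lt_i) (Ordinal lt_j); rewrite /= !prednK //; last by lia.
by apply; lia.
Qed.

End AdaptedBasis.

(* Main.v *)
(** By the Jacobi identity, the conditions alpha_(6,12) = 0 (from the
    commutativity of g^4) and alpha_(3,7) <> 0 (from [g^1,g^1] not in g^6) force
    the leading structure constants (alpha_(2,5), alpha_(3,7), alpha_(4,9),
    alpha_(5,11)) to be (420 t, 42 t, 6 t, t) with t <> 0, so that g is a
    filtered deformation of a truncated Witt algebra.
    The Jacobi identity also determines alpha_(4,10), alpha_(5,12), alpha_(4,11)
    and alpha_(4,12).

    Give e_i weight i.  Modulo coboundaries a cocycle w satisfies
    w(e_1, e_i) = 0 for i < 12, and the cocycle condition on (e_1, e_i, e_j)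
    then expresses w through c = w(e_1, e_12) and b_i = w(e_i, e_(i+1)),
    2 <= i <= 6.  The remaining conditions of weight 13, 11 and 9 read
    715 t b_6 = 130 t^2 c, 792 t b_5 = ... and 882 t b_4 = ...; they determine
    b_6, b_5 and b_4 from c, and all others follow from the Jacobi identity.
    The free parameters c, b_2, b_3 give omega, omega_1 and - omega_2. *)

Require Import Defs.
From mathcomp Require Import all_boot all_algebra.
From mathcomp Require Import ring zify.

Set Implicit Arguments.
Unset Strict Implicit.
Unset Printing Implicit Defensive.

Import GRing.Theory.
Local Open Scope ring_scope.

(** * Linear algebra *)

Lemma scale_regularE (K : fieldType) (x : K) (y : K^o) : x *: y = x * y.
Proof. by []. Qed.

Lemma lfun_eq0_on_span (K : fieldType) (U V : vectType K) (X : seq U)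
    (f : 'Hom(U, V)) :
  <<X>>%VS = fullv -> (forall i, (i < size X)%N -> f X`_i = 0) -> f = 0.
Proof.
move=> spanX f0; apply/lfunP=> x; rewrite zero_lfunE.
have /(coord_span (X := in_tuple X)) -> : x \in <<in_tuple X>>%VS.
  by rewrite spanX memvf.
by rewrite linear_sum big1 // => i _; rewrite linearZ /= f0 ?scaler0.
Qed.

Lemma lie_span (K : fieldType) (L : lieAlgType K) (X Y : seq L)
    (W : {vspace L}) :
    {in X & Y, forall x y, lie x y \in W} ->
  {in <<X>>%VS & <<Y>>%VS, forall x y, lie x y \in W}.
Proof.
move=> XYW x y Xx Yy.
rewrite (coord_span (X := in_tuple X) Xx) (coord_span (X := in_tuple Y) Yy).
rewrite linear_sumlz rpred_sum // => i _; rewrite linearZl_LR memvZ //.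
rewrite linear_sumr rpred_sum // => j _; rewrite linearZr_LR memvZ //.
by apply: XYW; apply: mem_nth.
Qed.

Lemma mem_liev (K : fieldType) (L : lieAlgType K) (U V : {vspace L}) u v :
  u \in U -> v \in V -> lie u v \in liev U V.
Proof. by move=> Uu Vv; move/lievP: (subvv (liev U V)); apply. Qed.

Lemma cochain_anti (K : fieldType) (L : lieAlgType K)
    (w : 'Hom(L, 'Hom(L, K^o))) x y : w \in cochain2 L -> w x y = - w y x.
Proof.
move=> /cochain2P alt; apply/eqP; rewrite -addr_eq0.
have := alt (x + y); rewrite linearD !linearD /= !add_lfunE !alt add0r addr0.
by rewrite addrC => ->.
Qed.

(** Recursion on an explicit coefficient list rather than a big sum, so that brackets and
    differentials of tables unfold by computation. *)
Fixpoint lincomb (K : fieldType) (V : lmodType K) (u : nat -> V) (m : nat)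
    (s : seq K) : V :=
  if s is x :: s' then x *: u m + lincomb u m.+1 s' else 0.

Lemma eq_lincomb (K : fieldType) (V : lmodType K) (u v : nat -> V) m s :
    (forall r, (m <= r < m + size s)%N -> u r = v r) ->
  lincomb u m s = lincomb v m s.
Proof.
elim: s m => [|x s IH] m //= uv; rewrite uv ?IH //; last by lia.
by move=> r hr; apply: uv; lia.
Qed.

Lemma lincomb_head (K : fieldType) (V : lmodType K) (u : nat -> V) m s :
  (forall r, (m < r)%N -> u r = 0) -> lincomb u m s = head 0 s *: u m.
Proof.
have lincomb0 s' k : (forall r, (k <= r)%N -> u r = 0) -> lincomb u k s' = 0.
  elim: s' k => [|x s' IH] k u0 //=.
  by rewrite u0 // scaler0 add0r IH // => r /ltnW /u0.
by case: s => [|x s] u0 /=; rewrite ?scale0r // lincomb0 // addr0.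
Qed.

Lemma lfun2_lincomb (K : fieldType) (U V : vectType K)
    (w : 'Hom(U, 'Hom(V, K^o))) u m s y :
  w (lincomb u m s) y = lincomb (fun r => w (u r) y : K^o) m s.
Proof.
elim: s m => [|x s IH] m /=; first by rewrite linear0 zero_lfunE.
by rewrite linearP /= add_lfunE scale_lfunE IH.
Qed.

(** * Structure constants *)

Section Tables.

Variables (K : fieldType) (a : nat -> nat -> K).
Implicit Type g : nat -> nat -> K.

(* For i < j, the coefficients of [e_i, e_j] on e_(i+j), e_(i+j+1), ...; those
   on e_r with r < i + j involve only alpha_(6,12), which vanishes under (c). *)
Definition bracket_row (i j : nat) : seq K :=
  match i, j with
  | 1, 12 => [::]
  | 1, _ => [:: 1]
  | 2, 3 => [:: a 2 5; a 2 6; a 2 7; a 2 8; a 2 9; a 2 10; a 2 11; a 2 12]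
  | 2, 4 => [:: a 2 5; a 2 6; a 2 7; a 2 8; a 2 9; a 2 10; a 2 11]
  | 2, 5 =>
      [:: a 2 5 - a 3 7; a 2 6 - a 3 8; a 2 7 - a 3 9; a 2 8 - a 3 10;
          a 2 9 - a 3 11; a 2 10 - a 3 12]
  | 2, 6 =>
      [:: a 2 5 - 2 * a 3 7; a 2 6 - 2 * a 3 8; a 2 7 - 2 * a 3 9;
          a 2 8 - 2 * a 3 10; a 2 9 - 2 * a 3 11]
  | 2, 7 =>
      [:: a 2 5 - 3 * a 3 7 + a 4 9; a 2 6 - 3 * a 3 8 + a 4 10;
          a 2 7 - 3 * a 3 9 + a 4 11; a 2 8 - 3 * a 3 10 + a 4 12]
  | 2, 8 =>
      [:: a 2 5 - 4 * a 3 7 + 3 * a 4 9; a 2 6 - 4 * a 3 8 + 3 * a 4 10;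
          a 2 7 - 4 * a 3 9 + 3 * a 4 11]
  | 2, 9 =>
      [:: a 2 5 - 5 * a 3 7 + 6 * a 4 9 - a 5 11;
          a 2 6 - 5 * a 3 8 + 6 * a 4 10 - a 5 12]
  | 2, 10 => [:: a 2 5 - 6 * a 3 7 + 10 * a 4 9 - 4 * a 5 11]
  | 3, 4 => [:: a 3 7; a 3 8; a 3 9; a 3 10; a 3 11; a 3 12]
  | 3, 5 => [:: a 3 7; a 3 8; a 3 9; a 3 10; a 3 11]
  | 3, 6 => [:: a 3 7 - a 4 9; a 3 8 - a 4 10; a 3 9 - a 4 11; a 3 10 - a 4 12]
  | 3, 7 => [:: a 3 7 - 2 * a 4 9; a 3 8 - 2 * a 4 10; a 3 9 - 2 * a 4 11]
  | 3, 8 => [:: a 3 7 - 3 * a 4 9 + a 5 11; a 3 8 - 3 * a 4 10 + a 5 12]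
  | 3, 9 => [:: a 3 7 - 4 * a 4 9 + 3 * a 5 11]
  | 4, 5 => [:: a 4 9; a 4 10; a 4 11; a 4 12]
  | 4, 6 => [:: a 4 9; a 4 10; a 4 11]
  | 4, 7 => [:: a 4 9 - a 5 11; a 4 10 - a 5 12]
  | 4, 8 => [:: a 4 9 - 2 * a 5 11]
  | 5, 6 => [:: a 5 11; a 5 12]
  | 5, 7 => [:: a 5 11]
  | _, _ => [::]
  end.

Definition skew_table g (i j : nat) : K :=
  if (i < j)%N then g i j else if (j < i)%N then - g j i else 0.

(* The value of the differential of w on (e_i, e_j, e_k), for the alternating
   form w with w e_i e_j = g i j whenever i < j. *)
Definition differential g (i j k : nat) : K :=
  lincomb (skew_table g ^~ k : nat -> K^o) (i + j)%N (bracket_row i j)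
  + lincomb (skew_table g ^~ i : nat -> K^o) (j + k)%N (bracket_row j k)
  - lincomb (skew_table g ^~ j : nat -> K^o) (i + k)%N (bracket_row i k).

Definition closed_table g : Prop :=
  forall i j k, [&& k <= 12, j < k, i < j & 0 < i]%N ->
    differential g i j k = 0.

(* The table forced by the cocycle condition on the triples (e_1, e_i, e_j) when
   e_1 pairs to 0 with e_i for i < 12 and to c with e_12, and e_i pairs to b_i
   with e_(i+1). *)
Definition form_table (c b2 b3 b4 b5 b6 : K) (i j : nat) : K :=
  match i, j with
  | 1, 12 => c
  | 2, 3 => b2
  | 2, 4 => a 2 12 * c
  | 2, 5 => a 2 11 * c - b3
  | 2, 6 => a 2 10 * c - 2 * a 3 12 * c
  | 2, 7 => a 2 9 * c - 3 * a 3 11 * c + b4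
  | 2, 8 => a 2 8 * c - 4 * a 3 10 * c + 3 * a 4 12 * c
  | 2, 9 => a 2 7 * c - 5 * a 3 9 * c + 6 * a 4 11 * c - b5
  | 2, 10 => a 2 6 * c - 6 * a 3 8 * c + 10 * a 4 10 * c - 4 * a 5 12 * c
  | 2, 11 => a 2 5 * c - 7 * a 3 7 * c + 15 * a 4 9 * c - 10 * a 5 11 * c + b6
  | 3, 4 => b3
  | 3, 5 => a 3 12 * c
  | 3, 6 => a 3 11 * c - b4
  | 3, 7 => a 3 10 * c - 2 * a 4 12 * c
  | 3, 8 => a 3 9 * c - 3 * a 4 11 * c + b5
  | 3, 9 => a 3 8 * c - 4 * a 4 10 * c + 3 * a 5 12 * c
  | 3, 10 => a 3 7 * c - 5 * a 4 9 * c + 6 * a 5 11 * c - b6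
  | 4, 5 => b4
  | 4, 6 => a 4 12 * c
  | 4, 7 => a 4 11 * c - b5
  | 4, 8 => a 4 10 * c - 2 * a 5 12 * c
  | 4, 9 => a 4 9 * c - 3 * a 5 11 * c + b6
  | 5, 6 => b5
  | 5, 7 => a 5 12 * c
  | 5, 8 => a 5 11 * c - b6
  | 6, 7 => b6
  | _, _ => 0
  end.

Lemma form_table_out c b2 b3 b4 b5 b6 i j :
  (12 < j)%N -> form_table c b2 b3 b4 b5 b6 i j = 0.
Proof. by do 13! [case: j => [|j] //]; do 8! [case: i => [|i] //]. Qed.

Definition bracket_coef (s i j : nat) : K :=
  if (i + j <= s)%N then (bracket_row i j)`_(s - (i + j)) else 0.

Local Ltac expand :=
  rewrite /differential /skew_table /bracket_coef /= ?scale_regularE.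

(* For a goal forall i j k, h i j k -> _, with h bounding k by a numeral, then j
   by k and i by j: runs tac on every triple for which h computes to true. *)
Local Ltac triples_with tac :=
  let i := fresh "i" in let j := fresh "j" in let k := fresh "k" in
  let h := fresh "h" in
  move=> i j k h;
  do 13! (case: k h => [|k] h; [first [by [] |
    do 13! (case: j h => [|j] h; [first [by [] |
      do 13! (case: i h => [|i] h; [first [by [] | tac] | try by []])]
      | try by []])] | try by []]).

(** For $i=1$ the table was built to satisfy the condition. For $i\ge2$ and $i+j+k>13$, every term
    is a multiple of an entry of weight above 13, and these are all zero. *)
Lemma differential_form_table c b2 b3 b4 b5 b6 i j k :
    [&& k <= 12, j < k, i < j & 0 < i]%N ->
    (i == 1) || (13 < i + j + k)%N ->
  differential (form_table c b2 b3 b4 b5 b6) i j k = 0.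
Proof.
by move: i j k; triples_with ltac:(first [by [] | by move=> _; expand; ring]).
Qed.

(** In the triples left over, $i+j\ge5$ and $i+j+k\le13$ give $k\le8$, which keeps the enumeration
    short. *)
Lemma closed_form_table c b2 b3 b4 b5 b6 :
    (forall i j k, [&& k <= 8, j < k, i < j, 1 < i & i + j + k <= 13]%N ->
      differential (form_table c b2 b3 b4 b5 b6) i j k = 0) ->
  closed_table (form_table c b2 b3 b4 b5 b6).
Proof.
move=> low i j k ijk.
have [triv | ] := boolP ((i == 1) || (13 < i + j + k)%N).
  exact: differential_form_table.
by rewrite negb_or => /andP[i_neq1 le13]; apply: low; lia.
Qed.

(** No relation among the [a k s] is needed: the nonzero entries have weight 5 or 7, while a
    differential on indices at least 2 only meets weights from 9 on. *)
Lemma closed_table_free b2 b3 : closed_table (form_table 0 b2 b3 0 0 0).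
Proof. by apply: closed_form_table; triples_with ltac:(by expand; ring). Qed.

(** * Structure constants forced by the Jacobi identity *)

Section JacobiIdentity.

Hypothesis charK0 : [pchar K] =i pred0.

Lemma natS_neq0 n : n.+1%:R != 0 :> K.
Proof. by move/pcharf0P: charK0 => ->. Qed.

(* The Jacobi identity: the coordinates of the bracket are coboundaries. *)
Hypothesis jacobi_a :
  forall s, (0 < s <= 12)%N -> closed_table (bracket_coef s).
Hypothesis a37_neq0 : a 3 7 != 0.

Local Notation t := (a 5 11).

(** Along $e_{i+j+k}$, the Jacobi identity on $(e_i,e_j,e_k)$ is a quadratic form in the four
    leading coefficients alone. As [a 3 7] is nonzero, [D234] makes [a 4 9] nonzero; elimination
    then gives [a 3 7 = 7 * a 4 9], and division by [a 4 9] the other ratios. *)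
Lemma leading_coefs : [/\ a 2 5 = 420 * t, a 3 7 = 42 * t & a 4 9 = 6 * t].
Proof.
pose D i j k := differential (bracket_coef (i + j + k)) i j k.
have D234 : D 2 3 4 = 0 by apply: jacobi_a.
have D245 : D 2 4 5 = 0 by apply: jacobi_a.
have D345 : D 3 4 5 = 0 by apply: jacobi_a.
have r_neq0 : a 4 9 != 0.
  apply: contraNneq a37_neq0 => r0.
  have : 3 * a 3 7 ^+ 2 = D 2 3 4 + (2 * a 2 5 + a 3 7) * a 4 9.
    by rewrite /D; expand; ring.
  rewrite D234 r0 mulr0 addr0 => /eqP.
  by rewrite mulf_eq0 sqrf_eq0 (negPf (natS_neq0 2)).
have q_r : a 3 7 = 7 * a 4 9.
  have : 2 * a 4 9 ^+ 3 * (a 3 7 - 7 * a 4 9) = 0.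
    (* Eliminates a 2 5 and t between the three Jacobi equations. *)
    transitivity (3 * (a 3 7 + a 4 9) * (a 4 9 * D 2 4 5 - t * D 2 3 4)
        + (a 4 9 + 3 * a 3 7) * (a 4 9 - a 3 7) * D 3 4 5).
      by rewrite /D; expand; ring.
    by rewrite D234 D245 D345; ring.
  move/eqP; rewrite !mulf_eq0 !(negPf r_neq0) (negPf (natS_neq0 1)) /=.
  by rewrite subr_eq0 => /eqP.
have r_t : a 4 9 = 6 * t.
  apply/(mulfI r_neq0)/(mulfI (natS_neq0 3))/subr0_eq.
  by rewrite -[RHS]D345 /D; expand; rewrite q_r; ring.
have p_r : a 2 5 = 70 * a 4 9.
  apply/(mulfI r_neq0)/(mulfI (natS_neq0 1))/subr0_eq/oppr_inj.
  by rewrite oppr0 -[RHS]D234 /D; expand; rewrite q_r; ring.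
by split; rewrite ?p_r ?q_r r_t; ring.
Qed.

Lemma a5_11_neq0 : t != 0.
Proof.
apply: contraNneq a37_neq0 => t0.
by have [_ -> _] := leading_coefs; rewrite t0 mulr0.
Qed.

(** One, two or three places above the leading coordinate, the Jacobi identity is affine in the
    coefficient sought, of slope $-882t$ or $-792t$; the proof multiplies by the inverse slope. *)
Lemma higher_coefs :
  [/\ a 4 10 = (46 * a 3 8 - 3 * a 2 6) / 147,
      a 5 12 = (118 * a 4 10 + 26 * a 3 8 - 3 * a 2 6) / 792,
      a 4 11 = (4 * a 3 8 ^+ 2 - 3 * (a 2 6 + a 3 8) * a 4 10
                + t * (301 * a 3 9 - 22 * a 2 7)) / (882 * t) &
      a 4 12 = (9 * a 3 8 * a 3 9 - 3 * (a 2 6 + a 3 8) * a 4 11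
                - (4 * a 2 7 + 6 * a 3 9) * a 4 10
                + (2 * a 2 7 + a 3 9) * a 5 12
                + t * (322 * a 3 10 - 25 * a 2 8)) / (882 * t)].
Proof.
have [p_t q_t r_t] := leading_coefs; have t_neq0 := a5_11_neq0.
have D0 s i j k : (0 < s <= 12)%N -> [&& k <= 12, j < k, i < j & 0 < i]%N ->
  differential (bracket_coef s) i j k = 0 by move=> hs; apply: jacobi_a.
have a4_10 : a 4 10 = (46 * a 3 8 - 3 * a 2 6) / 147.
  apply: subr0_eq.
  rewrite -[RHS](mulr0 (- (882 * t)^-1)) -(D0 10 2 3 4)%N //; expand.
  by rewrite p_t q_t r_t; field; rewrite t_neq0 !natS_neq0.
split=> //.
- apply: subr0_eq.
  rewrite -[RHS](mulr0 (- (792 * t)^-1)) -(D0 12 2 4 5)%N //; expand.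
  by rewrite p_t q_t r_t a4_10; field; rewrite t_neq0 !natS_neq0.
- apply: subr0_eq.
  rewrite -[RHS](mulr0 (- (882 * t)^-1)) -(D0 11 2 3 4)%N //; expand.
  by rewrite p_t q_t r_t; field; rewrite t_neq0 !natS_neq0.
- apply: subr0_eq.
  rewrite -[RHS](mulr0 (- (882 * t)^-1)) -(D0 12 2 3 4)%N //; expand.
  by rewrite p_t q_t r_t; field; rewrite t_neq0 !natS_neq0.
Qed.

Lemma affine_closed_table :
  exists b4 b5 b6, closed_table (form_table 1 0 0 b4 b5 b6).
Proof.
have [p_t q_t r_t] := leading_coefs; have t_neq0 := a5_11_neq0.
have [a4_10 a5_12 a4_11 a4_12] := higher_coefs.
(* The differential on (e_2, e_5, e_6), (e_2, e_4, e_5) and (e_2, e_3, e_4) is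
   affine in b6, b5 and b4, of slope -715 t, -792 t and -882 t respectively. *)
pose b6 := 2 / 11 * t.
pose b5 := differential (form_table 1 0 0 0 0 b6) 2 4 5 / (792 * t).
pose b4 := differential (form_table 1 0 0 0 b5 b6) 2 3 4 / (882 * t).
(* The differentials vanish identically once all determined coefficients are substituted; [a 4 12]
   is replaced first, since its formula involves the other three. *)
exists b4, b5, b6; apply: closed_form_table; triples_with ltac:(
  expand; rewrite /b4 /b5; expand; rewrite ?p_t ?q_t ?r_t /b6;
  rewrite ?a4_12 ?a4_11 ?a5_12 ?a4_10; by field; rewrite ?t_neq0 !natS_neq0).
Qed.

Lemma skew_anti g i j : skew_table g i j = - skew_table g j i.
Proof. by rewrite /skew_table; case: ltngtP; rewrite ?opprK ?oppr0. Qed.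

(** * Uniqueness: closed tables normalized on $e_1$ *)

Section Rigidity.

Variable g : nat -> nat -> K.
Hypotheses (closed_g : closed_table g)
  (g1 : forall j, g 1 j = 0) (g_out : forall i j, (12 < j)%N -> g i j = 0).

Lemma skew_out i j : (12 < i)%N || (12 < j)%N -> skew_table g i j = 0.
Proof.
by move=> hij; rewrite /skew_table; case: ltngtP => // lt_ij;
  rewrite g_out ?oppr0 //; lia.
Qed.

(** This is the cocycle condition on $(e_1,e_i,e_j)$: the term in $[e_i,e_j]$ drops out because [g]
    vanishes on $e_1$. Zero entries beyond 12 make the rule valid at index 12 too, where
    $[e_1,e_{12}]=0$. *)
Lemma skew_shift i j :
    (1 < i <= 12)%N -> (1 < j <= 12)%N ->
  skew_table g i.+1 j = - skew_table g i j.+1.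
Proof.
wlog lt_ij : i j / (i < j)%N => [shift_lt | hi hj].
  have [lt_ij | lt_ji | <-] := ltngtP i j => hi hj; first exact: shift_lt.
    by rewrite skew_anti [in RHS]skew_anti shift_lt // opprK.
  exact: skew_anti.
have row1 k : (1 < k < 12)%N -> bracket_row 1 k = [:: 1].
  by do 12! [case: k => [|k] //].
have lincomb1 (u : nat -> K^o) m : lincomb u m [:: 1] = u m.
  by rewrite /= scale1r addr0.
have rows0 :
    lincomb (skew_table g ^~ 1 : nat -> K^o) (i + j) (bracket_row i j) = 0.
  have u0 r : (1 < r)%N -> skew_table g r 1 = 0.
    by case: r => [|[|r]] // _; rewrite /skew_table /= g1 oppr0.
  by rewrite lincomb_head => [|r lt_r]; rewrite u0 ?scaler0 //; lia.
have : differential g 1 i j = 0 by apply: closed_g; lia.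
rewrite /differential rows0 addr0 row1 ?lincomb1; last lia.
move/subr0_eq->.
have [->|neq_j] := eqVneq j 12%N.
  by rewrite /= skew_out ?oppr0 //; lia.
by rewrite row1 ?lincomb1 ?[LHS]skew_anti //; lia.
Qed.

Definition vanishes_above n :=
  forall i j, (1 < i)%N -> (1 < j)%N -> (n < i + j)%N -> skew_table g i j = 0.

Lemma skew_shiftn k i j :
    (1 < i)%N -> (i + k <= 12)%N -> (1 < j)%N -> (j + k <= 12)%N ->
  skew_table g (i + k) j = (-1) ^+ k * skew_table g i (j + k).
Proof.
elim: k j => [|k IH] j hi hik hj hjk; first by rewrite !addn0 mul1r.
rewrite addnS skew_shift; try lia.
by rewrite IH ?addSnnS; try lia; rewrite exprS mulN1r mulNr.
Qed.

Lemma vanishes_aboveS i0 j0 :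
    (1 < i0 <= 12)%N -> (1 < j0 <= 12)%N -> skew_table g i0 j0 = 0 ->
  vanishes_above (i0 + j0) -> vanishes_above (i0 + j0).-1.
Proof.
move=> hi0 hj0 s0 van i j hi hj le_ij.
have [lt_ij | ge_ij] := ltnP (i0 + j0) (i + j); first exact: van.
have [out | ] := boolP ((12 < i) || (12 < j))%N; first exact: skew_out.
rewrite negb_or -!leqNgt => /andP[hi' hj'].
have [le_i | lt_i] := leqP i i0.
  have [k i0E] : exists k, i0 = (i + k)%N by exists (i0 - i)%N; lia.
  have jE : j = (j0 + k)%N by lia.
  have : skew_table g (i + k) j0 = (-1) ^+ k * skew_table g i (j0 + k).
    by apply: skew_shiftn => //; lia.
  by rewrite -i0E -jE s0 => /esym/eqP; rewrite mulf_eq0 signr_eq0 => /eqP.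
have [k iE] : exists k, i = (i0 + k)%N by exists (i - i0)%N; lia.
have j0E : j0 = (j + k)%N by lia.
by rewrite iE skew_shiftn -?j0E ?s0 ?mulr0 //; lia.
Qed.

(** Higher terms of each bracket only produce entries of weight above $i+j+k$, so the leading
    coefficients alone survive. *)
Lemma differential_top i j k : (1 < i < j)%N -> (j < k <= 12)%N ->
    vanishes_above (i + j + k) ->
  head 0 (bracket_row i j) * skew_table g (i + j) k
  + head 0 (bracket_row j k) * skew_table g (j + k) i
  - head 0 (bracket_row i k) * skew_table g (i + k) j = 0.
Proof.
move=> hij hjk van; rewrite -[RHS](@closed_g i j k); last lia.
by rewrite /differential !lincomb_head // => r lt_r; apply: van; lia.
Qed.

Hypotheses (g23 : g 2 3 = 0) (g25 : g 2 5 = 0).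

(* Descending induction on the weight i + j: by skew_shift, the values of a
   given weight all vanish as soon as one of them does.  In weights 13, 11 and 9
   that one vanishes by the top part of the cocycle condition, which multiplies
   it by 715 t, 792 t and 882 t. *)
Lemma rigidity i j : (0 < i < j)%N -> g i j = 0.
Proof.
have [p_t q_t r_t] := leading_coefs; have t_neq0 := a5_11_neq0.
have cancel m (x y : K) : y = m.+1%:R * t * x -> y = 0 -> x = 0.
  move=> -> /eqP; rewrite !mulf_eq0 (negPf (natS_neq0 m)) (negPf t_neq0).
  by move/eqP.
have skewxx m : skew_table g m m = 0 by rewrite /skew_table ltnn.
have shift m n : (1 < m <= 12)%N -> (1 < n <= 12)%N ->
  skew_table g m.+1 n = - skew_table g m n.+1 := @skew_shift m n.
(* In weights 24 down to 15, the pair $(12-k,12)$ shifts to $(11-k,13)$, which is out of range. *)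
have van14 k : (k <= 10)%N -> vanishes_above (24 - k).
  elim: k => [_ x y hx hy lt_xy | k IH lt_k]; first by apply: skew_out; lia.
  have -> : (24 - k.+1)%N = ((12 - k) + 12).-1 by lia.
  apply: vanishes_aboveS; try lia; last first.
    by have -> : (12 - k + 12 = 24 - k)%N; [lia | apply: IH; lia].
  have -> : (12 - k)%N = (11 - k).+1 by lia.
  by rewrite shift ?skew_out ?oppr0 //; lia.
(* In an even weight the diagonal entry is zero by antisymmetry. *)
have van13 : vanishes_above 13.
  by apply: (@vanishes_aboveS 7 7) => //; apply: (van14 10).
have van12 : vanishes_above 12.
  apply: (@vanishes_aboveS 7 6) => //.
  have := differential_top (i := 2) (j := 5) (k := 6) isT isT van13.
  (* With all entries shifted to $(7,6)$ the slope is $(378+1+336)t=715t$; [cancel m] divides by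
     $(m+1)t$. *)
  apply: (cancel 714); rewrite /=.
  rewrite p_t q_t (shift 7 5)%N // (shift 10 2)%N // (shift 9 3)%N //.
  rewrite (shift 8 4)%N // (shift 7 5)%N //; ring.
have van11 : vanishes_above 11 by apply: (@vanishes_aboveS 6 6).
have van10 : vanishes_above 10.
  apply: (@vanishes_aboveS 6 5) => //.
  have := differential_top (i := 2) (j := 4) (k := 5) isT isT van11.
  apply: (cancel 791); rewrite /=.
  rewrite p_t q_t r_t (shift 6 4)%N // (shift 8 2)%N // (shift 7 3)%N //.
  rewrite (shift 6 4)%N //; ring.
have van9 : vanishes_above 9 by apply: (@vanishes_aboveS 5 5).
have van8 : vanishes_above 8.
  apply: (@vanishes_aboveS 5 4) => //.
  have := differential_top (i := 2) (j := 3) (k := 4) isT isT van9.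
  apply: (cancel 881); rewrite /=.
  rewrite p_t q_t (shift 5 3)%N // (shift 6 2)%N // (shift 5 3)%N //; ring.
have van7 : vanishes_above 7 by apply: (@vanishes_aboveS 4 4).
have van6 : vanishes_above 6 by apply: (@vanishes_aboveS 2 5).
have van5 : vanishes_above 5 by apply: (@vanishes_aboveS 3 3).
have van4 : vanishes_above 4 by apply: (@vanishes_aboveS 2 3).
have van3 : vanishes_above 3 by apply: (@vanishes_aboveS 2 2).
case: i => [//|[|i]] lt_ij; first exact: g1.
have := van3 i.+2 j; rewrite /skew_table ifT; last lia.
by apply; lia.
Qed.

End Rigidity.

End JacobiIdentity.

End Tables.

(** * The bracket in an adapted basis *)

Section AdaptedBasis.

Variables (K : fieldType) (L : lieAlgType K) (e : 12.-tuple L).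
Local Notation "e_[ i ]" := (e`_(i.-1)) (format "e_[ i ]").
Hypothesis basis_e : basis_of fullv e.

Lemma free_e : free e. Proof. exact: basis_free basis_e. Qed.

Lemma span_e : <<e>>%VS = fullv. Proof. exact: span_basis. Qed.

Lemma e_out k : (12 < k)%N -> e_[k] = 0.
Proof. by case: k => // k lt_k; rewrite nth_default // size_tuple. Qed.

Lemma e_neq0 i : (0 < i <= 12)%N -> e_[i] != 0.
Proof.
move=> hi; apply: free_not0 free_e _; apply: mem_nth; rewrite size_tuple; lia.
Qed.

Section Brackets.

Variable alpha : nat -> nat -> K.
Hypothesis alpha0 : forall k s, ~~ adapted_index 12 k s -> alpha k s = 0.
Hypothesis lie1 : forall i, (2 <= i <= 11)%N -> lie e_[1] e_[i] = e_[i.+1].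
Hypothesis lie1_12 : lie e_[1] e_[12] = 0.
Hypothesis lieE : forall i j, (2 <= i < j)%N -> (j <= 12)%N ->
  lie e_[i] e_[j] =
    \sum_(1 <= r < 13)
      (\sum_(0 <= l < ((j - i - 1)./2).+1)
         (-1) ^+ l * 'C(j - i - l - 1, l)%:R
           * alpha (i + l)%N (r + i + 2 * l + 1 - j)%N) *: e_[r].

Lemma e_lower_central m i : (m.+2 <= i)%N -> e_[i] \in lower_central L m.
Proof.
elim: m i => [|m IH] i lt_i /=; first exact: memvf.
have [le_i | gt_i] := leqP i 12; last by rewrite e_out ?mem0v.
have -> : e_[i] = - lie e_[i.-1] e_[1].
  by rewrite -lieC lie1 ?prednK //; lia.
by rewrite memvN mem_liev ?memvf ?IH //; lia.
Qed.

(** Both $e_6$ and $e_7$ lie in $\mathfrak{g}^4$, and the only admissible coefficient in their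
    bracket is $\alpha_{6,12}$, along $e_{12}$. *)
Lemma alpha6_12 :
  liev (lower_central L 4) (lower_central L 4) = 0%VS -> alpha 6 12 = 0.
Proof.
move=> ab4; have : lie e_[6] e_[7] \in (0 : {vspace L})%VS.
  by rewrite -ab4 mem_liev ?e_lower_central.
have alphaE k s : alpha k s = if adapted_index 12 k s then alpha k s else 0.
  by case: ifPn => // /alpha0.
rewrite memv0 (lieE (i := 6) (j := 7)) //.
under eq_bigr do under eq_bigr do rewrite alphaE.
rewrite unlock /= !(mulr0, addr0, scale0r, add0r) expr0 bin0 !mul1r scaler_eq0.
by rewrite (negPf (@e_neq0 12 _)) // orbF => /eqP.
Qed.

Hypothesis alpha612 : alpha 6 12 = 0.

Lemma lie_tableE i j : (0 < i < j)%N -> (j <= 12)%N ->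
  lie e_[i] e_[j] = lincomb (fun r => e_[r]) (i + j) (bracket_row alpha i j).
Proof.
move=> /andP[i_gt0 lt_ij] le_j.
have [i1 | i_neq1] := eqVneq i 1%N.
  have [-> | j_neq12] := eqVneq j 12%N; first by rewrite i1 lie1_12.
  rewrite i1 lie1; last lia.
  move: le_j lt_ij j_neq12; rewrite i1.
  by do 13? [case: j => [|j] //=]; rewrite scale1r addr0.
(* The guard lets inadmissible coefficients compute to zero; [k < 6] also discards $\alpha_{6,12}$,
   the only admissible one with $k\ge6$. *)
have alphaE k s :
    alpha k s = if adapted_index 12 k s && (k < 6)%N then alpha k s else 0.
  case: ifPn => // /nandP[/alpha0 // | ]; rewrite -leqNgt => le_k.
  have [/andP[/eqP-> /eqP->] // | ks] := boolP ((k == 6) && (s == 12))%N.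
  by apply: alpha0; rewrite /adapted_index; lia.
rewrite lieE ?i_neq1 //; last lia.
under eq_bigr do under eq_bigr do rewrite alphaE.
have {}i_gt0 : (1 < i)%N by lia.
move: lt_ij i_gt0.
do 13! (case: j le_j => [|j] le_j; [first [by [] |
  do 13! (case: i i_neq1 => [|i] i_neq1; [first [by [] |
    move=> _ _; rewrite unlock /= /binomial /= !(mulr0, addr0, scale0r, add0r);
    rewrite //; do ?[congr (_ *: _ + _); first by ring
                    | congr (_ *: _); by ring]]
  | try by []])] | try by []]).
Qed.

End Brackets.

Variable a : nat -> nat -> K.
Hypothesis lie_table : forall i j, (0 < i < j)%N -> (j <= 12)%N ->
  lie e_[i] e_[j] = lincomb (fun r => e_[r]) (i + j) (bracket_row a i j).

Lemma lincomb_mem (W : {vspace L}) m s :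
    (forall r, (m <= r)%N -> e_[r] \in W) ->
  lincomb (fun r => e_[r]) m s \in W.
Proof.
elim: s m => [|x s IH] m eW /=; first exact: mem0v.
by rewrite memvD ?memvZ ?eW // IH // => r /ltnW /eW.
Qed.

Lemma mem_tail m r : (m < r)%N -> e_[r] \in <<drop m e>>%VS.
Proof.
move=> lt_m; have [le_r | gt_r] := leqP r 12; last by rewrite e_out ?mem0v.
have -> : e_[r] = (drop m e)`_(r.-1 - m) by rewrite nth_drop subnKC //; lia.
by rewrite memv_span // mem_nth // size_drop size_tuple; lia.
Qed.

Lemma tail_sub (W : {vspace L}) m :
  (forall r, (m < r)%N -> e_[r] \in W) -> (<<drop m e>> <= W)%VS.
Proof.
move=> eW; apply/span_subvP=> x /(nthP 0)[k lt_k <-].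
by rewrite nth_drop; apply: (eW (m + k).+1); lia.
Qed.

Lemma lie_tail_sub (W : {vspace L}) m :
    (forall i j, (m < i < j)%N -> (j <= 12)%N -> lie e_[i] e_[j] \in W) ->
  (liev <<drop m e>> <<drop m e>> <= W)%VS.
Proof.
move=> eW; apply/lievP; apply: lie_span => x y.
move=> /(nthP 0)[k lt_k <-] /(nthP 0)[l lt_l <-]; rewrite !nth_drop.
move: lt_k lt_l; rewrite !size_drop !size_tuple => lt_k lt_l.
have [lt_kl | lt_lk | ->] := ltngtP k l; last by rewrite liexx mem0v.
  by apply: (eW (m + k).+1 (m + l).+1); lia.
by rewrite lieC memvN; apply: (eW (m + l).+1 (m + k).+1); lia.
Qed.

Lemma lower_central1_sub : (lower_central L 1 <= <<drop 2 e>>)%VS.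
Proof.
rewrite /= (_ : fullv = <<drop 0 e>>%VS); last by rewrite drop0 span_e.
apply: lie_tail_sub => i j hij le_j; rewrite lie_table //.
by apply: lincomb_mem => r le_r; apply: mem_tail; lia.
Qed.

(** Among indices at least 3, only $(3,4)$ has sum at most 7, and its bracket meets $e_7$ through
    [a 3 7]. As $e_8,\dots,e_{12}$ lie in $\mathfrak{g}^6$, this will force [a 3 7] to be
    nonzero. *)
Lemma lie_lower_central1_sub : a 3 7 = 0 ->
  (liev (lower_central L 1) (lower_central L 1) <= <<drop 7 e>>)%VS.
Proof.
move=> a37; apply: subv_trans (_ : liev <<drop 2 e>> <<drop 2 e>> <= _)%VS.
  apply/lievP=> x y x1 y1.
  by apply: mem_liev; apply: (subvP lower_central1_sub).
apply: lie_tail_sub => i j hij le_j; rewrite lie_table //; last by lia.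
have [gt_ij | le_ij] := ltnP 7 (i + j).
  by apply: lincomb_mem => r le_r; apply: mem_tail; lia.
have [-> ->] : i = 3%N /\ j = 4%N by lia.
rewrite /= a37 scale0r add0r.
by apply: (@lincomb_mem _ 8 [:: _; _; _; _; _]) => r le_r; apply: mem_tail.
Qed.

Lemma e12_central : e_[12] \in center L.
Proof.
apply/centerP=> y; apply/eqP; rewrite -memv0.
apply: (@lie_span _ _ [:: e_[12]] e); rewrite ?memv_span1 ?span_e ?memvf //.
  move=> x z /[!inE]/eqP-> /(nthP 0)[k]; rewrite size_tuple => lt_k <-.
  have [-> | neq_k] := eqVneq k 11; first by rewrite liexx mem0v.
  rewrite lieC memvN (lie_table (i := k.+1) (j := 12)) //; last by lia.
  rewrite (_ : bracket_row a k.+1 12 = [::]) ?mem0v //.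
  by do 12! [case: k lt_k neq_k => [|k] lt_k neq_k //].
Qed.

(** * Two-forms and their tables *)

Implicit Types (w : 'Hom(L, 'Hom(L, K^o))) (g : nat -> nat -> K).

Lemma form_out w i j : (12 < j)%N -> w e_[i] e_[j] = 0.
Proof. by move=> lt_j; rewrite (e_out lt_j) linear0. Qed.

Lemma cochain_eq0 w : w \in cochain2 L ->
    (forall i j, (0 < i < j)%N -> (j <= 12)%N -> w e_[i] e_[j] = 0) ->
  w = 0.
Proof.
move=> Cw w0; apply: (lfun_eq0_on_span span_e) => i.
rewrite size_tuple => lt_i; apply: (lfun_eq0_on_span span_e) => j.
rewrite size_tuple => lt_j.
have [lt_ij | lt_ji | ->] := ltngtP i j; first exact: (w0 i.+1 j.+1).
  by rewrite cochain_anti // (w0 j.+1 i.+1) ?oppr0.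
by move/cochain2P: Cw.
Qed.

Lemma table_skew w i j :
    w \in cochain2 L ->
  skew_table (fun k l => w e_[k] e_[l] : K) i j = w e_[i] e_[j].
Proof.
move=> Cw; rewrite /skew_table.
case: ltngtP => [// | _ | ->]; first by rewrite -cochain_anti.
by move/cochain2P: Cw.
Qed.

Lemma coboundary2_table w g i j k :
    (forall r l, (0 < r)%N -> (0 < l)%N -> w e_[r] e_[l] = skew_table g r l) ->
    [&& k <= 12, j < k, i < j & 0 < i]%N ->
  coboundary2 L w e_[i] e_[j] e_[k] = differential a g i j k.
Proof.
move=> wg ijk; rewrite coboundary2E (lieC e_[k]) !lie_table; try lia.
rewrite linearN opp_lfunE !lfun2_lincomb /differential.
by congr (_ + _ - _); apply: (eq_lincomb (V := K^o)) => r hr; apply: wg; lia.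
Qed.

Lemma cocycle_closed_table w :
  w \in cocycles2 L -> closed_table a (fun i j => w e_[i] e_[j]).
Proof.
move=> Zw i j k ijk; have /cocycles2P[alt dw0] := Zw.
rewrite -(coboundary2_table (w := w)) ?coboundary2E // => r l _ _.
by rewrite table_skew //; apply/cochain2P.
Qed.

Lemma coord_lincomb s m x : (0 < m)%N -> (0 < s <= 12)%N ->
  coord e (inord s.-1) (lincomb (fun r => e_[r]) m x)
    = if (m <= s)%N then x`_(s - m) else 0.
Proof.
move=> m_gt0 hs; elim: x m m_gt0 => [|y x IH] m m_gt0 /=.
  by rewrite linear0 nth_nil if_same.
rewrite linearP /= IH // ?scale_regularE.
have -> : coord e (inord s.-1) e_[m] = (m == s)%:R.
  have [le_m | gt_m] := leqP m 12; last first.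
    by rewrite e_out // linear0; case: eqP => // ms; lia.
  rewrite (_ : m.-1 = (inord m.-1 : 'I_12)); last by rewrite inordK; lia.
  rewrite coord_free ?free_e // -val_eqE /= !inordK; try lia.
  by congr (nat_of_bool _)%:R; lia.
have [lt_ms | gt_ms | ->] := ltngtP m s.
- by rewrite mulr0 add0r; have -> : (s - m = (s - m.+1).+1)%N by lia.
- by rewrite mulr0 addr0.
- by rewrite mulr1 addr0 subnn.
Qed.

(** [bracket_coef a s] is the table of the coboundary of the $s$-th coordinate form, and
    coboundaries are cocycles by the Jacobi identity. *)
Lemma bracket_closed_table s :
  (0 < s <= 12)%N -> closed_table a (bracket_coef a s).
Proof.
move=> hs; pose f : 'Hom(L, K^o) := linfun (coord e (inord s.-1) : L -> K^o).
have fE x : f x = coord e (inord s.-1) x by rewrite lfunE.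
have /(subvP (coboundaries2_sub L))/cocycles2P[alt df0] :
    coboundary1 L f \in coboundaries2 L by apply: memv_img; apply: memvf.
move=> i j k ijk.
rewrite -(coboundary2_table (w := coboundary1 L f)) ?coboundary2E // => r l.
have coefE p q :
    (0 < p < q)%N -> coboundary1 L f e_[p] e_[q] = bracket_coef a s p q.
  move=> hpq; rewrite coboundary1E fE.
  have [le_q | gt_q] := leqP q 12.
    by rewrite lie_table // coord_lincomb //; lia.
  by rewrite (e_out gt_q) linear0r linear0 /bracket_coef ifN //; lia.
move=> r_gt0 l_gt0; rewrite -table_skew /skew_table; last exact/cochain2P.
by case: ltngtP => // *; rewrite coefE //; lia.
Qed.

Lemma alt_form_skew g r k : (forall i j, (12 < j)%N -> g i j = 0) ->
  (0 < r)%N -> (0 < k)%N -> alt_form e g e_[r] e_[k] = skew_table g r k.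
Proof.
move=> g_out r_gt0 k_gt0; rewrite -table_skew ?alt_form_cochain // /skew_table.
have ltE i j : (0 < i < j)%N -> alt_form e g e_[i] e_[j] = g i j.
  move=> hij; have [le_j | gt_j] := leqP j 12; first exact: alt_formE.
  by rewrite form_out // g_out.
by case: ltngtP => // lt_rk; rewrite ltE //; lia.
Qed.

(** The differential [J] is trilinear, cyclic and antisymmetric, so increasing triples of basis
    vectors suffice. *)
Lemma closed_alt_form g :
    closed_table a g -> (forall i j, (12 < j)%N -> g i j = 0) ->
  alt_form e g \in cocycles2 L.
Proof.
move=> closed_g g_out; have Cw := alt_form_cochain e g.
set w := alt_form e g in Cw *; pose J := coboundary2 L w.
have JE x y z : J x y z = w (lie x y) z + w (lie y z) x + w (lie z x) y.
  exact: coboundary2E.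
have Jcyc x y z : J x y z = J y z x by rewrite !JE; ring.
have Jswap x y z : J x y z = - J y x z.
  rewrite !JE (lieC y x) (lieC x z) (lieC z y) !linearN /= !opp_lfunE; ring.
have Jxx x z : J x x z = 0.
  rewrite JE liexx (lieC z x) linear0 linearN zero_lfunE opp_lfunE add0r.
  by rewrite subrr.
suff J0 : J = 0.
  apply/cocycles2P; split=> [|x y z]; first exact/cochain2P.
  by rewrite -JE J0 !zero_lfunE.
have Jlt i j k : [&& k <= 12, j < k, i < j & 0 < i]%N ->
    J e_[i] e_[j] e_[k] = 0.
  move=> ijk; rewrite /J (coboundary2_table (g := g)) ?closed_g // => r l.
  exact: alt_form_skew.
have Jlt12 i j k : (0 < i < j)%N -> (j <= 12)%N -> (0 < k <= 12)%N ->
    J e_[i] e_[j] e_[k] = 0.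
  move=> hij le_j hk.
  have [lt_jk | lt_kj | ->] := ltngtP j k; first by apply: Jlt; lia.
    have [lt_ik | lt_ki | ->] := ltngtP i k; last by rewrite Jcyc Jcyc Jxx.
      by rewrite Jcyc Jcyc Jswap Jlt ?oppr0 //; lia.
    by rewrite Jcyc Jcyc Jlt //; lia.
  by rewrite Jcyc Jxx.
apply: (lfun_eq0_on_span span_e) => i; rewrite size_tuple => lt_i.
apply: (lfun_eq0_on_span span_e) => j; rewrite size_tuple => lt_j.
apply: (lfun_eq0_on_span span_e) => k; rewrite size_tuple => lt_k.
have [lt_ij | lt_ji | ->] := ltngtP i j; last exact: Jxx.
  by apply: (Jlt12 i.+1 j.+1 k.+1).
by rewrite Jswap (Jlt12 j.+1 i.+1 k.+1) ?oppr0.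
Qed.

Lemma eq_alt_form g g' :
    (forall i j, (0 < i < j)%N -> (j <= 12)%N -> g i j = g' i j) ->
  alt_form e g = alt_form e g'.
Proof.
move=> gg'; apply/eqP; rewrite -subr_eq0; apply/eqP/cochain_eq0.
  by rewrite memvB ?alt_form_cochain.
move=> i j hij le_j; rewrite add_lfunE opp_lfunE add_lfunE opp_lfunE.
by rewrite !alt_formE // gg' // subrr.
Qed.

(** * The cocycles $\omega_1,\omega_2$ and normal forms modulo coboundaries *)

Lemma omega1E : omega1 e = alt_form e (form_table a 0 1 0 0 0 0).
Proof.
apply: eq_alt_form => i j hij le_j; move: hij.
do 13! (case: j le_j => [|j] le_j; [first [by [] |
  do 13! (case: i => [|i]; [first [by [] | by move=> _ /=; ring] | try by []])]
  | try by []]).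
Qed.

(** The parameter is $-1$ because [form_table] has $b_3$ at $(3,4)$ and $-b_3$ at $(2,5)$. *)
Lemma omega2E : omega2 e = alt_form e (form_table a 0 0 (-1) 0 0 0).
Proof.
apply: eq_alt_form => i j hij le_j; move: hij.
do 13! (case: j le_j => [|j] le_j; [first [by [] |
  do 13! (case: i => [|i]; [first [by [] | by move=> _ /=; ring] | try by []])]
  | try by []]).
Qed.

Lemma omega1_cocycle : omega1 e \in cocycles2 L.
Proof.
rewrite omega1E; apply: closed_alt_form; first exact: closed_table_free.
by move=> *; apply: form_table_out.
Qed.

Lemma omega2_cocycle : omega2 e \in cocycles2 L.
Proof.
rewrite omega2E; apply: closed_alt_form; first exact: closed_table_free.
by move=> *; apply: form_table_out.
Qed.

(** Since $[e_1,e_i]=e_{i+1}$, a linear form with $f(e_{i+1})=w(e_1,e_i)$ absorbs these values for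
    $2\le i\le11$; the value on $(e_1,e_{12})$ is out of its reach and is absorbed by [w0]. *)
Lemma cocycle_normalize w w0 :
    w0 \in cocycles2 L ->
    (forall j, (j <= 12)%N -> w0 e_[1] e_[j] = (j == 12)%:R) ->
    w \in cocycles2 L ->
  exists (c : K) (f : 'Hom(L, K^o)),
    forall j, (w - c *: w0 - coboundary1 L f) e_[1] e_[j] = 0.
Proof.
move=> /cocycles2P[alt0 _] w01 /cocycles2P[alt _].
(* Position $k$ of [v] prescribes $f(e_{k+1})$. Index 0 denotes $e_1$ as well, because its
   predecessor is 0. *)
pose v := [seq w e_[1] e_[k] | k <- iota 0 12].
have [f /(_ free_e) fe] := linear_of_free (rT := K^o) e v.
have {}fe i : (1 < i <= 12)%N -> f e_[i] = w e_[1] e_[i.-1].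
  move=> hi; have le_i : (i.-1 < 12)%N by lia.
  rewrite -(nth_map _ 0) ?size_tuple // fe ?size_map ?size_tuple //.
  by rewrite (nth_map 0%N) ?size_iota // nth_iota // add0n.
pose c : K := w e_[1] e_[12]; exists c, (linfun f) => j.
have -> : (w - c *: w0 - coboundary1 L (linfun f)) e_[1] e_[j]
    = w e_[1] e_[j] - c * w0 e_[1] e_[j] - f (lie e_[1] e_[j]).
  by rewrite !(add_lfunE, opp_lfunE, scale_lfunE) coboundary1E lfunE.
have [le_j | gt_j] := leqP j 12; last first.
  by rewrite (e_out gt_j) linear0r !linear0 mulr0 !(subr0, addr0).
case: j le_j => [|[|j]] le_j.
- by rewrite alt alt0 liexx linear0 mulr0 !(subr0, addr0).
- by rewrite alt alt0 liexx linear0 mulr0 !(subr0, addr0).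
rewrite w01 //; have [j12 | neq_j] := eqVneq j.+2 12.
  by rewrite lie_table ?le_j // j12 /= linear0 mulr1 subrr ?(oppr0, addr0).
rewrite lie_table ?le_j //.
have -> : lincomb (fun r => e_[r]) (1 + j.+2) (bracket_row a 1 j.+2) = e_[j.+3].
  by move: le_j neq_j; do 13? [case: j => [|j] //=]; rewrite scale1r addr0.
by rewrite fe ?mulr0 ?subr0 ?subrr //; lia.
Qed.

Hypotheses (charK0 : [pchar K] =i pred0) (a37_neq0 : a 3 7 != 0).

(** The coefficients are read off at $(2,3)$ and $(2,5)$; the difference then vanishes there and on
    $e_1$, so [rigidity] kills it. *)
Lemma normalized_cocycleE w :
    w \in cocycles2 L -> (forall j, w e_[1] e_[j] = 0) ->
  exists b2 b3 : K, w = b2 *: omega1 e + b3 *: omega2 e.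
Proof.
move=> Zw w1; pose b2 : K := w e_[2] e_[3]; pose b3 : K := w e_[2] e_[5].
exists b2, b3; apply/eqP; rewrite -subr_eq0 opprD addrA; apply/eqP.
set x := _ - _ - _.
have Zx : x \in cocycles2 L.
  apply: memvB; last exact: memvZ omega2_cocycle.
  by apply: memvB Zw _; apply: memvZ omega1_cocycle.
have o1E i j : (0 < i < j)%N -> (j <= 12)%N ->
    omega1 e e_[i] e_[j] = if (i, j) == (2, 3)%N then 1 else 0 :> K.
  exact: alt_formE.
have o2E i j : (0 < i < j)%N -> (j <= 12)%N ->
    omega2 e e_[i] e_[j] = if (i, j) == (2, 5)%N then 1 else
      if (i, j) == (3, 4)%N then -1 else 0 :> K.
  exact: alt_formE.
have xE i j : x e_[i] e_[j]
    = w e_[i] e_[j] - b2 * omega1 e e_[i] e_[j] - b3 * omega2 e e_[i] e_[j].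
  by rewrite /x !(add_lfunE, opp_lfunE, scale_lfunE).
have /cocycles2P[alt _] := Zx.
apply: cochain_eq0 => [|i j hij _]; first exact/cochain2P.
pose g (k l : nat) : K := x e_[k] e_[l].
have := @rigidity _ _ charK0 bracket_closed_table a37_neq0 g.
apply=> // [|k|k l||]; rewrite /g.
- exact: cocycle_closed_table.
- have [le_k | gt_k] := leqP k 12; last exact: form_out.
  case: k le_k => [|[|k]] le_k; try exact: alt.
  by rewrite xE w1 o1E // o2E //= !mulr0 !subr0.
- exact: form_out.
- by rewrite xE o1E // o2E //= mulr1 mulr0 subr0 subrr.
- by rewrite xE o1E // o2E //= mulr1 mulr0 subr0 subrr.
Qed.

End AdaptedBasis.

Theorem proposition4p9 (K : closedFieldType) (charK0 : [pchar K] =i pred0)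
    (L : lieAlgType K) (A2_L : class_A2_12 L)
    (e : 12.-tuple L) (adapted_e : adapted_basis e) :
  exists2 w : 'Hom(L, 'Hom(L, K^o)), affine_cocycle w &
    H2 L = <<[:: coclass (omega1 e); coclass (omega2 e); coclass w]>>%VS.
Proof.
have [_ _ _ ab4 ncomm1] := A2_L.
have [basis_e [a a0 [lie1 lie1_12 lieE]]] := adapted_e.
have a6_12 := alpha6_12 basis_e a0 lie1 lieE ab4.
have tableE := lie_tableE basis_e a0 lie1 lie1_12 lieE a6_12.
have a37_neq0 : a 3 7 != 0.
  apply/eqP => a37; apply: ncomm1.
  apply: subv_trans (lie_lower_central1_sub basis_e tableE a37) _.
  by apply: (tail_sub basis_e) => r lt_r; exact: (e_lower_central basis_e lie1).
have jacobi := bracket_closed_table basis_e tableE.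
have [b4 [b5 [b6 closed_w]]] := affine_closed_table charK0 jacobi a37_neq0.
pose w := alt_form e (form_table a 1 0 0 b4 b5 b6).
have Zw : w \in cocycles2 L.
  by apply: (closed_alt_form basis_e tableE) => // *; apply: form_table_out.
have w1 j : (j <= 12)%N -> w e`_0 e`_j.-1 = (j == 12)%:R.
  have /cocycles2P[alt _] := Zw.
  case: j => [|[|j]] le_j; try exact: alt.
  rewrite (alt_formE _ basis_e (i := 1) (j := j.+2)) //.
  by do 11! [case: j le_j => [|j] le_j //].
have Zo1 := omega1_cocycle basis_e tableE.
have Zo2 := omega2_cocycle basis_e tableE.
exists w.
  (* The form is affine: $w(e_{12},e_1)=-1$ with $e_{12}$ central. *)
  split=> //; exists e`_11; first exact: (e12_central basis_e tableE).
  exists e`_0; rewrite cochain_anti ?alt_form_cochain // (w1 12%N) //.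
  by apply/eqP; rewrite oppr_eq0 oner_eq0.
set s := [:: _; _; _]; apply/eqP; rewrite eqEsubv; apply/andP; split.
  apply/subvP=> _ /H2P[x Zx ->].
  have [c [f x1]] := cocycle_normalize basis_e tableE Zw w1 Zx.
  have Bf : coboundary1 L f \in coboundaries2 L.
    by apply: memv_img; apply: memvf.
  have Zf := subvP (coboundaries2_sub L) _ Bf.
  have [|b2 [b3 xE]] := normalized_cocycleE basis_e tableE charK0 a37_neq0 _ x1.
    by rewrite !memvB ?memvZ.
  (* By [xE], this difference is exactly the coboundary of [f]. *)
  have /vquot_classP clE :
      x - (b2 *: omega1 e + b3 *: omega2 e + c *: w) \in coboundaries2 L.
    have sumK (V : zmodType) (p q r : V) : p - (p - q - r + q) = r.
      by rewrite (addrAC (p - q)) subrK opprB addrC subrK.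
    by rewrite -xE sumK.
  have spanP k : (k < 3)%N -> s`_k \in <<s>>%VS.
    by move=> lt_k; apply/memv_span/mem_nth.
  rewrite /coclass clE linearD linearD linearZ linearZ linearZ /=.
  apply: memvD; last exact: memvZ (spanP 2 isT).
  by apply: memvD; [apply: memvZ (spanP 0 isT) | apply: memvZ (spanP 1 isT)].
apply/span_subvP=> _ /(nthP 0)[[|[|[|//]]] _ <-]; apply/H2P.
- by exists (omega1 e).
- by exists (omega2 e).
- by exists w.
Qed.
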